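(* Let $\alpha:\{1,2,3,\ldots\}\to(0,\infty)$ be a fixed non-decreasing function, let $(b_n)_{n\ge 1}$ be any sequence of positive integers tending to infinity, and let $\Phi^*=\{\phi_n^*\}_{n\ge1}$ be the histogram-based density estimation scheme determined by $\alpha$ and $(b_n)$ as defined in the context. Then $\Phi^*$ is $L_1$-consistent for $\Omega(\alpha)$; that is, for every density $f\in\mathcal{F}(\alpha)$ and every sequence $\mathbf{x}=(x_1,x_2,\ldots)$ of real numbers with limiting density $f$, $$\int_{\mathbb{R}} |\phi_n^*(x:x_1,\ldots,x_n)-f(x)|\,dx\to 0\quad\text{as } n\to\infty.$$
   Context: A density is a function $f:\mathbb{R}\to\mathbb{R}$ that is measurable, nonnegative and has $\int_{\mathbb{R}} f\,dx=1$; write $\mu_f(A)=\int_A f(x)\,dx$. Densities are functions (not equivalence classes) for the purpose of variation below. Limiting density: an infinite sequence $\mathbf{x}=(x_1,x_2,\ldots)$ of real numbers has limiting density $f$ if $\hat\mu_n(A)=\frac1n\sum_{i=1}^n I\{x_i\in A\}\to\mu_f(A)$ as $n\to\infty$ for every interval $A\subseteq\mathbb{R}$. Let $\Omega(f)$ be the set of all sequences with limiting density $f$. Variation: for a real-valued function $h$ on $[a,b)$, $V(h:a,b)=\sup\sum_{i=1}^n|h(t_i)-h(t_{i-1})|$, the supremum being over all finite sequences $a\le t_0<\cdots<t_n<b$. For non-decreasing $\alpha:\{1,2,\ldots\}\to(0,\infty)$, $\mathcal{F}(\alpha)$ is the set of all densities $f$ on $\mathbb{R}$ with $V(f:-i,i)<\alpha(i)$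 for all integers $i\ge1$, and $\Omega(\alpha)=\bigcup_{f\in\mathcal{F}(\alpha)}\Omega(f)$. The scheme $\Phi^*$: for $k\ge1$ let $\pi_k$ be the partition of $\mathbb{R}$ into the dyadic intervals $A_{k,j}=[j2^{-k},(j+1)2^{-k})$, $j\in\mathbb{Z}$, and let $\pi_k[x]$ be the cell of $\pi_k$ containing $x$. Given $x_1,\ldots,x_n$, define $$\hat h_{n,k}(x)=\frac{2^k}{n}\sum_{i=1}^n I\{x_i\in\pi_k[x]\},$$ $$k_n=\max\{1\le k\le b_n:\ V(\hat h_{n,k}:-i,i)<4\alpha(i)\ \text{for } 1\le i\le k\},$$ and $\phi_n^*(x:x_1,\ldots,x_n)=\hat h_{n,k_n}(x)$. If no $k$ with $1\le k\le b_n$ satisfies the condition defining $k_n$, then $\phi_n^*\equiv0$. *)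

(* Defs.v *)
From HB Require Import structures.
From mathcomp Require Import all_boot all_order all_algebra.
From mathcomp Require Import all_classical all_reals all_analysis.

Set Implicit Arguments.
Unset Strict Implicit.
Unset Printing Implicit Defensive.

Import Order.TTheory GRing.Theory Num.Theory.
Import numFieldNormedType.Exports.

Local Open Scope classical_set_scope.
Local Open Scope ring_scope.

(* Measurability is with respect to the Borel sets. Since functions in
   [density_class] below have bounded variation on every [-i, i[, they are
   Borel, so reading "measurable" as Lebesgue measurable would give the same
   class. *)
Definition is_density (R : realType) (f : R -> R) : Prop :=
  [/\ measurable_fun [set: R] f,
      (forall x, 0 <= f x) &
      (\int[lebesgue_measure]_x (f x)%:E = 1)%E].

Definition density_measure (R : realType) (f : R -> R) (A : set R) : \bar R :=
  (\int[lebesgue_measure]_(x in A) (f x)%:E)%E.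

(* Finite samples x_1, ..., x_n are indexed by 'I_n and infinite sequences
   x_1, x_2, ... by nat, both starting at 0. *)
Definition empirical (R : realType) (n : nat) (x : 'I_n -> R) (A : set R) : R :=
  (\sum_(i < n) \1_A (x i)) / n%:R.

Definition first_terms (R : realType) (x : nat -> R) (n : nat) : 'I_n -> R :=
  fun i => x i.

Definition has_limiting_density (R : realType) (f : R -> R) : set (nat -> R) :=
  [set x | forall A : interval R,
     (empirical (first_terms x (n := n)) [set` A])%:E @[n --> \oo]
       --> density_measure f [set` A]].

(* Variation on the half-open interval [a, b[, where the values of h at and
   beyond b play no role; the library's [total_variation] is about [a, b]. *)
Definition variation_co (R : realType) (h : R -> R) (a b : R) : \bar R :=
  ereal_sup [set v | exists (n : nat) (t : nat -> R),
    [/\ a <= t 0%N,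
        (forall i, (i < n)%N -> t i < t i.+1),
        t n < b &
        v = (\sum_(i < n) `|h (t i.+1) - h (t i)|)%:E]].

(* The value alpha 0 is never used. *)
Definition density_class (R : realType) (alpha : nat -> R) : set (R -> R) :=
  [set f | is_density f /\
    forall i : nat, (1 <= i)%N ->
      (variation_co f (- i%:R) i%:R < (alpha i)%:E)%E].

Definition dyadic (R : realType) (k : nat) (j : int) : set R :=
  `[j%:~R / 2 ^+ k, (j + 1)%:~R / 2 ^+ k[%classic.

Definition dyadic_cell (R : realType) (k : nat) (y : R) : set R :=
  \bigcup_(j in [set j | dyadic k j y]) dyadic k j.

Definition histogram (R : realType) (n : nat) (x : 'I_n -> R) (k : nat)
    (y : R) : R :=
  2 ^+ k / n%:R * \sum_(i < n) \1_(dyadic_cell k y) (x i).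

Definition admissible (R : realType) (alpha : nat -> R) (n : nat)
    (x : 'I_n -> R) (k : nat) : Prop :=
  forall i : nat, (1 <= i <= k)%N ->
    (variation_co (histogram x k) (- i%:R) i%:R < (4 * alpha i)%:E)%E.

(* The value is 0 exactly when no k with 1 <= k <= b n is admissible. *)
Definition resolution (R : realType) (alpha : nat -> R) (b : nat -> nat)
    (n : nat) (x : 'I_n -> R) : nat :=
  \max_(1 <= k < (b n).+1 | `[< admissible alpha x k >]) k.

Definition phi_star (R : realType) (alpha : nat -> R) (b : nat -> nat)
    (n : nat) (x : 'I_n -> R) (y : R) : R :=
  if resolution alpha b x == 0%N then 0
  else histogram x (resolution alpha b x) y.

Definition L1_consistent (R : realType)
    (phi : forall n : nat, ('I_n -> R) -> R -> R) (F : set (R -> R)) : Prop :=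
  forall f : R -> R, F f -> forall x : nat -> R, has_limiting_density f x ->
    (\int[lebesgue_measure]_y `|phi n (first_terms x (n := n)) y - f y|%:E)%E
      @[n --> \oo] --> 0%E.

(* Main.v *)
(** Fix a level m and a window [-i, i). On each dyadic cell of level m a
    function differs from its average by at most its variation on the cell, so
    on the window it is within 2^-m times its variation of its cell averages in
    L1. This applies to f and, uniformly in n, to the selected histogram, whose
    variation is below 4 alpha(i) by admissibility. As soon as the selected
    level is at least m, the cell averages of the histogram are the normalised
    empirical frequencies of the cells, which converge to those of f; outside
    the window both functions have small mass. The selected level tends to
    infinity because, at a fixed level k, the variation of the histogram is a
    finite sum of jumps converging to the one for the cell averages of f, which
    is below 4 alpha(i). *)
Require Import Defs.
From mathcomp Require Import all_boot all_order all_algebra.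
From mathcomp Require Import all_classical all_reals all_analysis.
From mathcomp Require Import measurable_realfun ring lra zify.
Set Implicit Arguments.
Unset Strict Implicit.
Unset Printing Implicit Defensive.

Import Order.TTheory GRing.Theory Num.Theory.
Import numFieldNormedType.Exports.
Local Open Scope classical_set_scope.
Local Open Scope ring_scope.

(** * Variation on half-open intervals and along grids *)

Lemma variation_co_sup (R : realType) (h : R -> R) (a b : R) (n : nat)
    (t : nat -> R) :
  a <= t 0%N -> (forall i, (i < n)%N -> t i < t i.+1) -> t n < b ->
  ((\sum_(i < n) `|h (t i.+1) - h (t i)|)%:E <= variation_co h a b)%E.
Proof. by move=> at0 tS tnb; apply: ereal_sup_ubound; exists n, t. Qed.

Lemma variation_co_ge0 (R : realType) (h : R -> R) (a b : R) :
  a < b -> (0 <= variation_co h a b)%E.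
Proof.
move=> ab; have := @variation_co_sup _ h a b 0 (fun=> a).
by rewrite big_ord0; apply.
Qed.

Lemma variation_co_osc (R : realType) (h : R -> R) (a b y z : R) :
  a <= y < b -> a <= z < b -> (`|h y - h z|%:E <= variation_co h a b)%E.
Proof.
wlog yz : y z / y <= z => [hw|] yab zab.
  by case/orP: (le_total y z) => ?; [|rewrite distrC]; apply: hw.
case/andP: yab zab => ay yb /andP[az zb].
move: yz; rewrite le_eqVlt => /predU1P[<-|yz].
  by rewrite subrr normr0 variation_co_ge0 // (le_lt_trans ay).
have := @variation_co_sup R h a b 1 (fun i => if i is 0%N then y else z).
by rewrite big_ord1 distrC; apply => // -[].
Qed.

(** Sequences in the two halves concatenate to one in [[a, c[]. Equality can fail: a jump of [h] at
    [b] from the left counts on the whole interval but on neither half. *)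
Lemma variation_coD (R : realType) (h : R -> R) (a b c : R) :
  a < b -> b < c ->
  (variation_co h a b + variation_co h b c <= variation_co h a c)%E.
Proof.
move=> ab bc.
pose sums (y z : R) := [set v | exists (n : nat) (t : nat -> R),
  [/\ y <= t 0%N, (forall i, (i < n)%N -> t i < t i.+1), t n < z &
    v = (\sum_(i < n) `|h (t i.+1) - h (t i)|)%:E]].
have concat v1 v2 : sums a b v1 -> sums b c v2 ->
    (v1 + v2 <= variation_co h a c)%E.
  move=> [n [t [at0 tS tb ->]]] [m [u [bu0 uS uc ->]]].
  (* The points of [t] followed by those of [u], with [u 0] at index [n.+1]; the term of index [n]
     is the extra jump across [b]. *)
  pose w i := if (i <= n)%N then t i else u (i - n.+1)%N.
  have -> : ((\sum_(i < n) `|h (t i.+1) - h (t i)|)%:E +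
      (\sum_(i < m) `|h (u i.+1) - h (u i)|)%:E <= variation_co h a c)%E =
    ((\sum_(i < n) `|h (w i.+1) - h (w i)| +
      \sum_(i < m) `|h (w (n.+1 + i).+1) - h (w (n.+1 + i)%N)|)%:E
      <= variation_co h a c)%E.
    congr (_ <= _)%E; rewrite -EFinD; congr (_ + _)%:E; apply: eq_bigr => i _.
      by rewrite /w ltn_ord ltnW.
    rewrite /w !ifF; last 2 first.
    - by apply/negbTE; rewrite -ltnNge; lia.
    - by apply/negbTE; rewrite -ltnNge; lia.
    by congr `|h (u _) - h (u _)|; lia.
  apply: (@le_trans _ _ (\sum_(i < n.+1 + m) `|h (w i.+1) - h (w i)|)%:E).
    rewrite lee_fin big_split_ord /= big_ord_recr /= lerD2r lerDl.
    exact: normr_ge0.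
  apply: variation_co_sup.
  - by rewrite /w leq0n.
  - move=> i im; rewrite /w; case: (ltnP i n) => [ilt|ige].
      by rewrite ltnW //; apply: tS.
    case: (ltnP n i) => [ni|ile].
      by rewrite subSn //; apply: uS; lia.
    have -> : i = n by lia.
    by rewrite subnn (lt_le_trans tb).
  - by rewrite /w ifF ?addKn//; apply/negbTE; rewrite -ltnNge; lia.
have step v2 : sums b c v2 ->
    (variation_co h a b + v2 <= variation_co h a c)%E.
  move=> hv2; have v2fin : v2 \is a fin_num by case: hv2 => ? [? [_ _ _ ->]].
  rewrite -leeBrDr//; apply: ge_ereal_sup => v1 hv1.
  by rewrite leeBrDr//; apply: concat.
have [abfin|abinf] := boolP (variation_co h a b \is a fin_num).
  rewrite -leeBrDl//; apply: ge_ereal_sup => v2 hv2.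
  by rewrite leeBrDl//; apply: step.
(* An infinite variation cannot be moved across the inequality; here the one-point sequence at [b]
   already forces the right-hand side to be infinite. *)
have abE : variation_co h a b = +oo%E.
  apply/eqP; apply: contraNT abinf => aboo.
  by rewrite ge0_fin_numE ?variation_co_ge0// ltey.
have : (variation_co h a b + 0 <= variation_co h a c)%E.
  apply: step; exists 0%N, (fun=> b).
  by split=> //; rewrite big_ord0.
rewrite abE addye// leye_eq => /eqP->.
by rewrite leey.
Qed.

Lemma incr_grid_lt (R : realType) (p : nat -> R) :
  (forall q, p q < p q.+1) -> {mono p : m n / (m < n)%N >-> m < n}.
Proof. by move=> pS; exact: (leW_mono (le_mono (homo_ltn lt_trans pS))). Qed.

Lemma incr_prefix_le (R : realType) (t : nat -> R) (n : nat) :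
  (forall i, (i < n)%N -> t i < t i.+1) -> t 0%N <= t n.
Proof.
elim: n => [//|n IH] tS; rewrite (le_trans (IH _) (ltW (tS n _)))// => i iN.
exact/tS/ltnW.
Qed.

Lemma variation_co_cells (R : realType) (h : R -> R) (p : nat -> R) (N : nat) :
  (forall q, p q < p q.+1) ->
  (\sum_(q < N.+1) variation_co h (p q) (p q.+1)
    <= variation_co h (p 0%N) (p N.+1))%E.
Proof.
move=> pS; elim: N => [|N IH]; first by rewrite big_ord1.
rewrite big_ord_recr /=.
apply: (le_trans (leeD2r _ IH)); apply: variation_coD => //.
by rewrite (incr_grid_lt pS).
Qed.

(** The witness is the variation on each cell: it dominates the oscillation there, and it is finite
    because the cell variations are nonnegative and sum to at most [C]. *)
Lemma osc_cells (R : realType) (h : R -> R) (p : nat -> R) (N : nat) (C : R) :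
  (forall q, p q < p q.+1) -> 0 <= C ->
  (variation_co h (p 0%N) (p N) <= C%:E)%E ->
  exists w : nat -> R,
    (forall q y z, (q < N)%N -> p q <= y < p q.+1 -> p q <= z < p q.+1 ->
       `|h y - h z| <= w q) /\
    \sum_(q < N) w q <= C.
Proof.
move=> pS C0; case: N => [|N] hC.
  by exists (fun=> 0); split=> //; rewrite big_ord0.
have sumC := le_trans (variation_co_cells h N pS) hC.
have V0 q : (0 <= variation_co h (p q) (p q.+1))%E by apply: variation_co_ge0.
have fin q : (q < N.+1)%N -> variation_co h (p q) (p q.+1) \is a fin_num.
  move=> qN; rewrite ge0_fin_numE//; apply: le_lt_trans (ltry C).
  apply: le_trans sumC.
  by rewrite (bigD1 (Ordinal qN))//= leeDl// sume_ge0.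
exists (fun q => fine (variation_co h (p q) (p q.+1))); split.
  by move=> q y z qN hy hz; rewrite -lee_fin fineK ?fin// variation_co_osc.
rewrite -lee_fin -sumEFin; apply: le_trans sumC.
by apply: lee_sum => q _; rewrite fineK// fin.
Qed.

Lemma grid_cell (R : realType) (p : nat -> R) (N : nat) (y : R) :
  p 0%N <= y < p N -> exists2 q, (q < N)%N & p q <= y < p q.+1.
Proof.
elim: N => [|N IH] /andP[py yp]; first by have := le_lt_trans py yp; rewrite ltxx.
have [yN|Ny] := ltP y (p N); last by exists N => //; rewrite Ny.
by have [|q qN ?] := IH; [rewrite py|exists q => //; apply: ltnW].
Qed.

(** An increasing sequence of points crosses each cell boundary at most once, and an increment of
    [h] is at most the sum of the jumps crossed. *)
Lemma variation_co_step (R : realType) (h : R -> R) (p c : nat -> R) (N : nat) :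
  (forall q, p q < p q.+1) ->
  (forall q y, (q < N.+1)%N -> p q <= y < p q.+1 -> h y = c q) ->
  (variation_co h (p 0%N) (p N.+1)
    <= (\sum_(q < N) `|c q.+1 - c q|)%:E)%E.
Proof.
move=> pS hc; apply: ge_ereal_sup => _ [n [t [t0 tS tN ->]]]; rewrite lee_fin.
have plt := incr_grid_lt pS.
(* Strengthened for the induction: only the jumps before the cell of the last point are charged, so
   those up to the cell of the next point remain available. *)
have : forall q, (q < N.+1)%N -> p q <= t n < p q.+1 ->
    \sum_(i < n) `|h (t i.+1) - h (t i)| <= \sum_(0 <= r < q) `|c r.+1 - c r|.
  elim: n tS tN => [|n IH] tS tN q qN tq; first by rewrite big_ord0 sumr_ge0.
  have tnS : t n < t n.+1 by apply: tS.
  have t0n : t 0%N <= t n by apply: incr_prefix_le => i iN; exact/tS/ltnW.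
  have [|q' q'N tq'] := @grid_cell R p N.+1 (t n).
    by rewrite (le_trans t0 t0n)/= (lt_trans tnS).
  have q'q : (q' <= q)%N.
    rewrite -ltnS -plt; case/andP: tq' => + _ => /le_lt_trans; apply.
    by case/andP: tq => _; apply: lt_trans.
  rewrite big_ord_recr/= (big_cat_nat _ (n := q'))//=; apply: lerD.
    apply: IH => // [i iN|]; first exact/tS/ltnW.
    exact: lt_trans tN.
  rewrite (hc q)// (hc q')// -telescope_sumr//.
  exact: ler_norm_sum.
move=> bnd.
have t0n : t 0%N <= t n by apply: incr_prefix_le.
have [|q qN tq] := @grid_cell R p N.+1 (t n); first by rewrite (le_trans t0 t0n).
apply: (le_trans (bnd q qN tq)).
rewrite -(big_mkord xpredT (fun r => `|c r.+1 - c r|)).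
by rewrite (big_cat_nat _ (n := q) (p := N))//= lerDl sumr_ge0.
Qed.

(** * L1 distance estimated through cell averages *)

Lemma integral_cst_itvco (R : realType) (a b r : R) : a <= b ->
  (\int[lebesgue_measure]_(z in [set` `[a, b[]) r%:E = (r * (b - a))%:E)%E.
Proof.
move=> ab; rewrite (integral_cst _ _ r%:E); last exact: measurable_itv.
rewrite /= lebesgue_measure_itv /= lte_fin; case: ltP => [//|ba].
by have -> : b - a = 0 by lra; rewrite mule0 mulr0.
Qed.

Lemma integral_itvco_osc (R : realType) (g : R -> R) (a b w I y : R) :
  measurable_fun [set: R] g -> (forall z, 0 <= g z) ->
  (\int[lebesgue_measure]_(z in [set` `[a, b[]) (g z)%:E = I%:E)%E ->
  a <= y < b -> (forall z, a <= z < b -> `|g y - g z| <= w) ->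
  `|I - (b - a) * g y| <= (b - a) * w.
Proof.
move=> mg g0 gI yab osc.
have ab : a <= b by case/andP: yab => ay yb; rewrite ltW// (le_lt_trans ay).
have w0 : 0 <= w by rewrite (le_trans _ (osc y yab)).
have mA : measurable [set` `[a, b[] := measurable_itv `[a, b[.
have mgA : measurable_fun [set` `[a, b[] (EFin \o g).
  by apply/measurable_EFinP; apply: measurable_funS mg.
have up : I <= (g y + w) * (b - a).
  rewrite -lee_fin -integral_cst_itvco// -gI; apply: ge0_le_integral => //=.
  - by move=> z _; rewrite lee_fin.
  - move=> z; rewrite /= in_itv /= => /osc.
    by rewrite lee_fin ler_norml => /andP[]; lra.
(* Integrates [g y <= g z + w] rather than [g y - w <= g z], whose left side may be negative, so
   that only nonnegative integrands occur. *)
have low : g y * (b - a) <= I + w * (b - a).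
  rewrite -lee_fin EFinD -!integral_cst_itvco// -gI -ge0_integralD//=; last first.
  - by move=> z _; rewrite lee_fin.
  apply: ge0_le_integral => //=.
  - by move=> z _; rewrite lee_fin.
  - exact: emeasurable_funD.
  - move=> z; rewrite /= in_itv /= => /osc.
    by rewrite -EFinD lee_fin ler_norml => /andP[]; lra.
by rewrite ler_norml; apply/andP; split; nra.
Qed.

(** Pointwise, the triangle inequality through the two averages bounds the distance by
    [|I1 - I2| / (b - a) + w1 + w2]; this constant is then integrated. *)
Lemma integral_dist_itvco (R : realType) (g1 g2 : R -> R)
    (a b w1 w2 I1 I2 : R) :
  a < b ->
  measurable_fun [set: R] g1 -> (forall z, 0 <= g1 z) ->
  measurable_fun [set: R] g2 -> (forall z, 0 <= g2 z) ->
  (\int[lebesgue_measure]_(z in [set` `[a, b[]) (g1 z)%:E = I1%:E)%E ->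
  (\int[lebesgue_measure]_(z in [set` `[a, b[]) (g2 z)%:E = I2%:E)%E ->
  (forall y z, a <= y < b -> a <= z < b -> `|g1 y - g1 z| <= w1) ->
  (forall y z, a <= y < b -> a <= z < b -> `|g2 y - g2 z| <= w2) ->
  (\int[lebesgue_measure]_(z in [set` `[a, b[]) `|g1 z - g2 z|%:E
    <= (`|I1 - I2| + (b - a) * (w1 + w2))%:E)%E.
Proof.
move=> ab mg1 g10 mg2 g20 gI1 gI2 osc1 osc2.
have ba : 0 < b - a by rewrite subr_gt0.
have -> : `|I1 - I2| + (b - a) * (w1 + w2) =
    (`|I1 - I2| / (b - a) + (w1 + w2)) * (b - a).
  by field; rewrite gt_eqF.
rewrite -(integral_cst_itvco _ (ltW ab)); apply: ge0_le_integral => //=.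
- apply/measurable_EFinP; apply: measurableT_comp => //.
  by apply: measurable_funB; [exact: measurable_funS mg1|exact: measurable_funS mg2].
- move=> y; rewrite /= in_itv /= => yab; rewrite lee_fin.
  have h1 := integral_itvco_osc mg1 g10 gI1 yab (fun z => osc1 y z yab).
  have h2 := integral_itvco_osc mg2 g20 gI2 yab (fun z => osc2 y z yab).
  rewrite -(ler_pM2l ba) mulrDr mulrCA divff ?gt_eqF// mulr1 mulrDr.
  rewrite -{1}(gtr0_norm ba) -normrM mulrBr.
  move: h1 h2; rewrite (distrC I1); set u := (b - a) * g1 y; set v := (b - a) * g2 y.
  move=> h1 h2.
  have -> : u - v = (u - I1) + (I1 - I2) + (I2 - v) by ring.
  have n1 := ler_normD ((u - I1) + (I1 - I2)) (I2 - v).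
  have n2 := ler_normD (u - I1) (I1 - I2).
  lra.
Qed.

Lemma integral_grid (R : realType) (G : R -> \bar R) (p : nat -> R) (N : nat) :
  measurable_fun [set: R] G -> (forall z, (0 <= G z)%E) ->
  (forall q, p q < p q.+1) ->
  (\int[lebesgue_measure]_(z in [set` `[p 0%N, p N[]) G z =
   \sum_(q < N) \int[lebesgue_measure]_(z in [set` `[p q, p q.+1[]) G z)%E.
Proof.
move=> mG G0 pS; elim: N => [|N IH].
  by rewrite big_ord0 set_itvco0 integral_set0.
rewrite big_ord_recr/= -IH -ge0_integral_setU//=.
- rewrite -itv_bndbnd_setU// bnd_simp; last exact: ltW.
  have : {homo p : m n / (m <= n)%N >-> m <= n}.
    by apply: homo_leq => // [? ? ?|i]; [exact: le_trans|exact: ltW].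
  exact.
- exact: measurable_funS mG.
- apply/disj_setPS => z [] /=; rewrite !in_itv/= => /andP[_ zp] /andP[pz _].
  by have := le_lt_trans pz zp; rewrite ltxx.
Qed.

(* Both functions are compared with their averages over the grid cells, which
   they leave by at most their oscillation. *)
Lemma integral_dist_grid (R : realType) (g1 g2 : R -> R) (p : nat -> R)
    (N : nat) (l : R) (w1 w2 I1 I2 : nat -> R) :
  0 < l -> (forall q, p q.+1 = p q + l) ->
  measurable_fun [set: R] g1 -> (forall z, 0 <= g1 z) ->
  measurable_fun [set: R] g2 -> (forall z, 0 <= g2 z) ->
  (forall q, (q < N)%N -> \int[lebesgue_measure]_(z in [set` `[p q, p q.+1[])
     (g1 z)%:E = (I1 q)%:E)%E ->
  (forall q, (q < N)%N -> \int[lebesgue_measure]_(z in [set` `[p q, p q.+1[])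
     (g2 z)%:E = (I2 q)%:E)%E ->
  (forall q y z, (q < N)%N -> p q <= y < p q.+1 -> p q <= z < p q.+1 ->
     `|g1 y - g1 z| <= w1 q) ->
  (forall q y z, (q < N)%N -> p q <= y < p q.+1 -> p q <= z < p q.+1 ->
     `|g2 y - g2 z| <= w2 q) ->
  (\int[lebesgue_measure]_(z in [set` `[p 0%N, p N[]) `|g1 z - g2 z|%:E
    <= (\sum_(q < N) `|I1 q - I2 q| +
        l * (\sum_(q < N) w1 q + \sum_(q < N) w2 q))%:E)%E.
Proof.
move=> l0 pl mg1 g10 mg2 g20 gI1 gI2 osc1 osc2.
have pS q : p q < p q.+1 by rewrite pl ltrDl.
rewrite integral_grid//; last first.
  by apply/measurable_EFinP; apply: measurableT_comp => //; apply: measurable_funB.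
rewrite -big_split/= mulr_sumr -big_split/= -sumEFin; apply: lee_sum => q _.
have -> : l = p q.+1 - p q by rewrite pl addrC addKr.
apply: integral_dist_itvco => //; try exact: gI1; try exact: gI2.
- by move=> y z; apply: osc1.
- by move=> y z; apply: osc2.
Qed.

(** * Dyadic cells and integrals of histograms *)

Lemma dyadic_cellE (R : realType) (k : nat) (y : R) :
  dyadic_cell k y =
  [set z | Num.floor (z * 2 ^+ k) = Num.floor (y * 2 ^+ k)].
Proof.
have dyE j (z : R) : dyadic k j z <-> Num.floor (z * 2 ^+ k) = j.
  have k0 : 0 < 2 ^+ k :> R by rewrite exprn_gt0.
  rewrite /dyadic /= in_itv /= ler_pdivrMr// ltr_pdivlMr//.
  by rewrite -floor_eq; split=> /eqP.
apply/seteqP; split=> [z [j /= /dyE yj /dyE zj]|z zy]; first by rewrite /= zj.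
by exists (Num.floor (y * 2 ^+ k)) => /=; apply/dyE.
Qed.

Lemma dyadic_cell_itv (R : realType) (k : nat) (y : R) :
  dyadic_cell k y = dyadic k (Num.floor (y * 2 ^+ k)).
Proof.
have k0 : 0 < 2 ^+ k :> R by rewrite exprn_gt0.
rewrite dyadic_cellE; apply/seteqP; split=> z;
  rewrite /dyadic /= in_itv /= ler_pdivrMr// ltr_pdivlMr// -floor_eq.
- by move/eqP.
- by move/eqP.
Qed.

Lemma measurable_dyadic_cell (R : realType) (k : nat) (y : R) :
  measurable (dyadic_cell k y).
Proof. by rewrite dyadic_cell_itv; exact: measurable_itv. Qed.

Lemma lebesgue_measure_dyadic_cell (R : realType) (k : nat) (y : R) :
  lebesgue_measure (dyadic_cell k y) = (2 ^- k)%:E.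
Proof.
have k0 : 0 < 2 ^- k :> R by rewrite invr_gt0 exprn_gt0.
rewrite dyadic_cell_itv /dyadic lebesgue_measure_itv /= lte_fin ltr_pM2r//.
by rewrite ltr_int ltrDl ltr01 -EFinD -mulrBl -intrB addrC addKr mul1r.
Qed.

(** Lying in the same cell is symmetric, so the cell of [y] can be traded for the fixed cell of each
    sample point. The histogram becomes a finite combination of indicators, which gives its
    measurability and its integrals. *)
Lemma histogramE (R : realType) (n : nat) (x : 'I_n -> R) (k : nat) :
  histogram x k =
  fun y => \sum_(i < n) (2 ^+ k / n%:R) * \1_(dyadic_cell k (x i)) y.
Proof.
apply/funext => y; rewrite /histogram mulr_sumr; apply: eq_bigr => i _.
by congr (_ * _); rewrite !indicE; congr (nat_of_bool _)%:R; rewrite !dyadic_cellE;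
  apply/idP/idP => /set_mem/= h; apply/mem_set.
Qed.

Lemma histogram_ge0 (R : realType) (n : nat) (x : 'I_n -> R) (k : nat) (y : R) :
  0 <= histogram x k y.
Proof.
by rewrite mulr_ge0 ?divr_ge0 ?exprn_ge0// sumr_ge0// => i _; rewrite indicE.
Qed.

Lemma measurable_histogram (R : realType) (n : nat) (x : 'I_n -> R) (k : nat) :
  measurable_fun [set: R] (histogram x k).
Proof.
rewrite histogramE; apply: measurable_sum => i.
apply: measurable_funM => //.
by apply: measurable_indic; exact: measurable_dyadic_cell.
Qed.

(** The last hypothesis says that [A] is a union of cells of level [k]. The cell of a sample point
    is then inside [A] or disjoint from it, and each sample point carries mass [1/n]. *)
Lemma integral_histogram (R : realType) (n : nat) (x : 'I_n -> R) (k : nat)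
    (A : set R) :
  (0 < n)%N -> measurable A ->
  (forall y z, Num.floor (y * 2 ^+ k) = Num.floor (z * 2 ^+ k) -> A y -> A z) ->
  (\int[lebesgue_measure]_(y in A) (histogram x k y)%:E = (empirical x A)%:E)%E.
Proof.
move=> n0 mA satA.
have c0 : 0 <= 2 ^+ k / n%:R :> R by rewrite divr_ge0 ?exprn_ge0.
rewrite histogramE.
under eq_integral do rewrite -sumEFin.
rewrite ge0_integral_sum//; last first.
  move=> i; apply/measurable_EFinP; apply: measurable_funM => //.
  by apply: measurable_indic; exact: measurable_dyadic_cell.
rewrite /empirical mulr_suml -sumEFin; apply: eq_bigr => i _.
under eq_integral do rewrite EFinM.
rewrite ge0_integralZl//; last first.
  apply/measurable_EFinP.
  by apply: measurable_indic; exact: measurable_dyadic_cell.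
rewrite integral_indic//; last exact: measurable_dyadic_cell.
have [xA|xA] := pselect (A (x i)).
  have -> : dyadic_cell k (x i) `&` A = dyadic_cell k (x i).
    apply/setIidPl; rewrite dyadic_cellE => y /= yx; exact: (satA (x i)).
  rewrite /= lebesgue_measure_dyadic_cell -EFinM indicE mem_set// mul1r.
  by rewrite mulrAC divff ?mul1r// expf_neq0.
have -> : dyadic_cell k (x i) `&` A = set0.
  rewrite dyadic_cellE; apply/seteqP; split=> // y [/= yx Ay].
  by apply: xA; exact: (satA y).
by rewrite measure0 mule0 indicE memNset// mul0r.
Qed.

(** * The dyadic grid of a window *)

(** The dyadic points of level [m] numbered by naturals from [-i], itself a dyadic point; the window
    [[-i, i[] has [2 i 2^m] cells. *)
Definition dyadic_grid (R : realType) (i m q : nat) : R :=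
  q%:R / 2 ^+ m - i%:R.

Lemma dyadic_gridS (R : realType) (i m q : nat) :
  dyadic_grid R i m q.+1 = dyadic_grid R i m q + 2 ^- m.
Proof. by rewrite /dyadic_grid -addn1 natrD mulrDl mul1r addrAC. Qed.

Lemma dyadic_grid_lt (R : realType) (i m q : nat) :
  dyadic_grid R i m q < dyadic_grid R i m q.+1.
Proof. by rewrite dyadic_gridS ltrDl invr_gt0 exprn_gt0. Qed.

Lemma dyadic_grid0 (R : realType) (i m : nat) : dyadic_grid R i m 0 = - i%:R.
Proof. by rewrite /dyadic_grid mul0r add0r. Qed.

Lemma dyadic_grid_end (R : realType) (i m : nat) :
  dyadic_grid R i m (i.*2 * 2 ^ m) = i%:R.
Proof.
rewrite /dyadic_grid natrM natrX mulfK ?expf_neq0//.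
by rewrite -addnn natrD addrK.
Qed.

(** A grid point of level [m <= k] is an integer multiple of [2^-k], so its position relative to [y]
    depends only on the cell of level [k] containing [y]. Hence intervals of the coarse grid are
    unions of fine cells. *)
Lemma dyadic_grid_le_floor (R : realType) (i m k q : nat) (y : R) :
  (m <= k)%N ->
  (dyadic_grid R i m q <= y) =
  (((q : int) - ((i * 2 ^ m)%N : int)) * ((2 ^ (k - m))%N : int)
     <= Num.floor (y * 2 ^+ k)).
Proof.
move=> mk.
have k0 j : 0 < 2 ^+ j :> R by rewrite exprn_gt0.
rewrite floor_ge_int intrM intrB -!pmulrn natrM !natrX -(ler_pM2r (k0 k)).
have -> : 2 ^+ k = 2 ^+ (k - m) * 2 ^+ m :> R by rewrite -exprD subnK.
congr (_ <= _); rewrite /dyadic_grid; field.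
by rewrite gt_eqF.
Qed.

Lemma dyadic_grid_saturated (R : realType) (i m k q r : nat) (y z : R) :
  (m <= k)%N -> Num.floor (y * 2 ^+ k) = Num.floor (z * 2 ^+ k) ->
  dyadic_grid R i m q <= y < dyadic_grid R i m r ->
  dyadic_grid R i m q <= z < dyadic_grid R i m r.
Proof.
move=> mk yz; rewrite !ltNge.
by rewrite !(dyadic_grid_le_floor _ _ _ mk) yz.
Qed.

Lemma integral_histogram_grid (R : realType) (n : nat) (x : 'I_n -> R)
    (i m k q r : nat) :
  (0 < n)%N -> (m <= k)%N ->
  (\int[lebesgue_measure]_(y in [set` `[dyadic_grid R i m q, dyadic_grid R i m r[])
     (histogram x k y)%:E =
   (empirical x [set` `[dyadic_grid R i m q, dyadic_grid R i m r[])%:E)%E.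
Proof.
move=> n0 mk; apply: integral_histogram => //.
by move=> y z yz; rewrite /= !in_itv /=; apply: dyadic_grid_saturated yz.
Qed.

Lemma histogram_grid_cell (R : realType) (n : nat) (x : 'I_n -> R)
    (i k q : nat) (y : R) :
  dyadic_grid R i k q <= y < dyadic_grid R i k q.+1 ->
  histogram x k y = 2 ^+ k *
    empirical x [set` `[dyadic_grid R i k q, dyadic_grid R i k q.+1[].
Proof.
move=> yq; rewrite /histogram /empirical -mulrA; congr (_ * _).
rewrite mulrC; congr (_ * _); apply: eq_bigr => l _.
rewrite !indicE; congr (nat_of_bool _)%:R; rewrite dyadic_cellE.
have cellE (z : R) : dyadic_grid R i k q <= z < dyadic_grid R i k q.+1 ->
    Num.floor (z * 2 ^+ k) = (q : int) - ((i * 2 ^ k)%N : int).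
  rewrite ltNge !(dyadic_grid_le_floor _ _ _ (leqnn k)) subnn expn0 !mulr1.
  lia.
apply/idP/idP => /set_mem /=; rewrite ?in_itv /= => h; apply/mem_set => /=.
  by rewrite in_itv /=; exact: (dyadic_grid_saturated (leqnn k) (esym h) yq).
by rewrite !cellE.
Qed.

(** * Limiting frequencies and admissibility of a fixed level *)

Lemma fin_num_density_measure (R : realType) (f : R -> R) (A : set R) :
  is_density f -> measurable A -> density_measure f A \is a fin_num.
Proof.
move=> [mf f0 f1] mA; rewrite ge0_fin_numE; last first.
  by apply: integral_ge0 => z _; rewrite lee_fin.
apply: (@le_lt_trans _ _ 1%E); last exact: ltry.
rewrite -f1; apply: ge0_subset_integral => //.
- by apply/measurable_EFinP.
- by move=> z _; rewrite lee_fin.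
Qed.

Lemma cvg_empirical (R : realType) (f : R -> R) (x : nat -> R) (A : interval R) :
  is_density f -> has_limiting_density f x ->
  empirical (first_terms x (n := n)) [set` A] @[n --> \oo]
    --> fine (density_measure f [set` A]).
Proof.
move=> df /(_ A); rewrite -[X in _ --> X -> _]fineK; last first.
  exact: fin_num_density_measure.
by move/fine_cvgP => [].
Qed.

Lemma cvg_density_measure_itv (R : realType) (f : R -> R) :
  is_density f ->
  density_measure f [set` `[(- i%:R), i%:R[] @[i --> \oo] --> 1%E.
Proof.
move=> [mf f0 f1]; rewrite -f1.
have -> : [set: R] = \bigcup_i [set` `[(- i%:R), i%:R[].
  apply/seteqP; split=> // z _; exists (Num.truncn `|z|).+1 => //=.
  have := truncnS_gt `|z|; rewrite in_itv /= ltr_norml => /andP[zl ->].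
  by rewrite ltW.
apply: ge0_nondecreasing_set_cvg_integral.
- move=> i j ij; apply/subsetPset => z /=; rewrite !in_itv /= => /andP[zl zr].
  have ijR : i%:R <= j%:R :> R by rewrite ler_nat.
  by apply/andP; split; lra.
- by move=> i; exact: measurable_itv.
- by move=> i; apply/measurable_EFinP; apply: measurable_funS mf.
- by move=> i z _; rewrite lee_fin.
Qed.

(* Going from one cell average to the next through the values of f at the left
   end points of the two cells costs at most three times the variation of f;
   the factor 4 in [admissible] leaves room for this. *)
Lemma grid_variation_density (R : realType) (f : R -> R) (i k N : nat) (C : R) :
  is_density f -> 0 <= C ->
  let p := dyadic_grid R i k in
  (variation_co f (p 0%N) (p N.+1) <= C%:E)%E ->
  \sum_(q < N)
    `|2 ^+ k * fine (density_measure f [set` `[p q.+1, p q.+2[])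
      - 2 ^+ k * fine (density_measure f [set` `[p q, p q.+1[])| <= 3 * C.
Proof.
move=> df C0 p Vp; have pS : forall q, p q < p q.+1 by apply: dyadic_grid_lt.
have [w [osc wC]] := osc_cells pS C0 Vp.
have k0 : 0 < 2 ^+ k :> R by rewrite exprn_gt0.
have step : \sum_(q < N) `|f (p q.+1) - f (p q)| <= C.
  rewrite -lee_fin; apply: le_trans Vp.
  exact: (variation_co_sup f (lexx _) (fun q _ => pS q) (pS N)).
(* The cell average differs from the value at the left end point by at most the oscillation on the
   cell. *)
have avg q : (q < N.+1)%N ->
    `|2 ^+ k * fine (density_measure f [set` `[p q, p q.+1[]) - f (p q)| <= w q.
  move=> qN; have [mf f0 _] := df.
  have pq : p q <= p q < p q.+1 by rewrite lexx pS.
  have := @integral_itvco_osc R f (p q) (p q.+1) (w q)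
    (fine (density_measure f [set` `[p q, p q.+1[])) (p q) mf f0.
  rewrite -[X in X = _ -> _]/(density_measure f [set` `[p q, p q.+1[]).
  rewrite fineK; last exact: fin_num_density_measure.
  move=> /(_ erefl pq (fun z => osc q (p q) z qN pq)).
  have -> : p q.+1 - p q = 2 ^- k by rewrite /p dyadic_gridS addrC addKr.
  rewrite -(ler_pM2l k0) -{1}(gtr0_norm k0) -normrM mulrBr !mulrA.
  by rewrite divff ?gt_eqF// !mul1r.
have w0 q : (q < N.+1)%N -> 0 <= w q.
  by move=> qN; apply: le_trans (avg q qN).
(* Each of the [N] steps uses the oscillations of both adjacent cells: the left ones omit the last
   cell and the right ones the first, so each family sums to at most [C]. The jumps of [f] give the
   third [C]. *)
have wl : \sum_(q < N) w q <= C.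
  by apply: le_trans wC; rewrite big_ord_recr /= lerDl w0.
have wr : \sum_(q < N) w q.+1 <= C.
  by apply: le_trans wC; rewrite big_ord_recl /= lerDr w0.
apply: (@le_trans _ _
    (\sum_(q < N) (w q.+1 + `|f (p q.+1) - f (p q)| + w q))); last first.
  by rewrite !big_split /=; lra.
apply: ler_sum => q _.
have h1 := avg q.+1 (ltn_ord q); have h2 := avg q (ltnW (ltn_ord q)).
rewrite distrC in h2; move: h1 h2.
set u := 2 ^+ k * _; set v := 2 ^+ k * _ => h1 h2.
have -> : u - v = (u - f (p q.+1)) + (f (p q.+1) - f (p q)) + (f (p q) - v).
  by ring.
have n1 := ler_normD ((u - f (p q.+1)) + (f (p q.+1) - f (p q))) (f (p q) - v).
have n2 := ler_normD (u - f (p q.+1)) (f (p q.+1) - f (p q)).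
lra.
Qed.

Lemma near_admissible (R : realType) (alpha : nat -> R) (f : R -> R)
    (x : nat -> R) (k : nat) :
  density_class alpha f -> has_limiting_density f x ->
  \forall n \near \oo, admissible alpha (first_terms x (n := n)) k.
Proof.
move=> [df Vf] fx.
(* Only finitely many windows are tested at level [k], so it suffices to treat each one
   eventually. *)
suff : \forall n \near \oo, forall i : 'I_k.+1, (0 < i)%N ->
    (variation_co (histogram (first_terms x (n := n)) k) (- i%:R) i%:R
      < (4 * alpha i)%:E)%E.
  apply: filterS => n h i /andP[i1 ik].
  by apply: (h (Ordinal (ik : (i < k.+1)%N))).
apply: filter_forall => i.
have [i0|i0] := posnP i; first exact: nearW.
have ai0 : 0 < alpha i.
  rewrite -lte_fin; apply: le_lt_trans (Vf i i0); apply: variation_co_ge0.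
  by rewrite gtrN// ltr0n.
pose p := dyadic_grid R i k.
have [N NE] : exists N, (i.*2 * 2 ^ k)%N = N.+1.
  by exists (i.*2 * 2 ^ k).-1; rewrite prednK// muln_gt0 double_gt0 i0 expn_gt0.
have pE : p N.+1 = i%:R by rewrite /p -NE dyadic_grid_end.
have p0 : p 0%N = - i%:R by exact: dyadic_grid0.
pose c (n q : nat) : R := 2 ^+ k *
  empirical (first_terms x (n := n)) [set` `[p q, p q.+1[].
pose d q : R := 2 ^+ k * fine (density_measure f [set` `[p q, p q.+1[]).
have cvgc q : c n q @[n --> \oo] --> d q.
  by apply: cvgMr; exact: cvg_empirical.
have cvgS : \sum_(q < N) `|c n q.+1 - c n q| @[n --> \oo]
    --> \sum_(q < N) `|d q.+1 - d q|.
  apply: cvg_big => [|q _]; first exact: add_continuous.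
  by apply: cvg_norm; apply: cvgB; exact: cvgc.
(* Positivity of [alpha i] makes [3 * alpha i < 4 * alpha i] strict, so the bound on the limit
   passes to all large [n]. *)
have dlt : \sum_(q < N) `|d q.+1 - d q| < 4 * alpha i.
  apply: (@le_lt_trans _ _ (3 * alpha i)); last lra.
  apply: grid_variation_density => //; first exact: ltW.
  by rewrite -/p p0 pE ltW// Vf.
have : \forall n \near \oo, \sum_(q < N) `|c n q.+1 - c n q| < 4 * alpha i.
  exact: cvgr_lt cvgS _ dlt.
apply: filterS => n cn _; rewrite -p0 -pE.
apply: (@le_lt_trans _ _ (\sum_(q < N) `|c n q.+1 - c n q|)%:E).
  apply: variation_co_step => [q|q y _ yq]; first exact: dyadic_grid_lt.
  exact: histogram_grid_cell.
by rewrite lte_fin.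
Qed.

(** * The selected level *)

(** A finite maximum is attained, unless it is the default value 0 of the empty one. *)
Lemma resolution_admissible (R : realType) (alpha : nat -> R) (b : nat -> nat)
    (n : nat) (x : 'I_n -> R) :
  resolution alpha b x != 0%N -> admissible alpha x (resolution alpha b x).
Proof.
have : resolution alpha b x = 0%N \/ admissible alpha x (resolution alpha b x).
  apply: (big_ind (fun k => k = 0%N \/ admissible alpha x k)); first by left.
  - by move=> k l hk hl; rewrite /maxn; case: ifP.
  - by move=> k /asboolP; right.
by case=> [->|].
Qed.

Lemma leq_resolution (R : realType) (alpha : nat -> R) (b : nat -> nat)
    (n : nat) (x : 'I_n -> R) (k : nat) :
  (0 < k <= b n)%N -> admissible alpha x k -> (k <= resolution alpha b x)%N.
Proof.
move=> /andP[k0 kb] ak; apply: (@leq_bigmax_seq _ _ _ id) => //.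
  by rewrite mem_index_iota k0.
exact/asboolP.
Qed.

Lemma near_resolution (R : realType) (alpha : nat -> R) (b : nat -> nat)
    (f : R -> R) (x : nat -> R) (k : nat) :
  b n @[n --> \oo] --> \oo -> (0 < k)%N ->
  density_class alpha f -> has_limiting_density f x ->
  \forall n \near \oo, (k <= resolution alpha b (first_terms x (n := n)))%N.
Proof.
move=> binf k0 cf fx; have /cvgnyPge/(_ k) kb := binf.
near=> n; apply: leq_resolution; last by near: n; exact: near_admissible cf fx.
by rewrite k0 /=; near: n.
Unshelve. all: by end_near. Qed.

(** * Mass outside a window and the L1 limit *)

(** Outside [B] the distance is at most [g1 + g2], and the masses left there are [1 - J1] and
    [1 - J2]. *)
Lemma integral_dist_tail (R : realType) (g1 g2 : R -> R) (B : set R)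
    (J1 J2 : R) :
  measurable B ->
  measurable_fun [set: R] g1 -> (forall z, 0 <= g1 z) ->
  measurable_fun [set: R] g2 -> (forall z, 0 <= g2 z) ->
  (\int[lebesgue_measure]_z (g1 z)%:E = 1)%E ->
  (\int[lebesgue_measure]_z (g2 z)%:E = 1)%E ->
  (\int[lebesgue_measure]_(z in B) (g1 z)%:E = J1%:E)%E ->
  (\int[lebesgue_measure]_(z in B) (g2 z)%:E = J2%:E)%E ->
  (\int[lebesgue_measure]_z `|g1 z - g2 z|%:E <=
   \int[lebesgue_measure]_(z in B) `|g1 z - g2 z|%:E
     + ((1 - J1) + (1 - J2))%:E)%E.
Proof.
move=> mB mg1 g10 mg2 g20 g11 g21 gJ1 gJ2.
have mCB : measurable (~` B) by exact: measurableC.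
have split (G : R -> R) : measurable_fun [set: R] G -> (forall z, 0 <= G z) ->
    (\int[lebesgue_measure]_z (G z)%:E =
     \int[lebesgue_measure]_(z in B) (G z)%:E
       + \int[lebesgue_measure]_(z in ~` B) (G z)%:E)%E.
  move=> mG G0; rewrite -ge0_integral_setU//= ?setUv//.
  - by apply/measurable_EFinP.
  - by move=> z _; rewrite lee_fin.
  - by apply/disj_setPS; rewrite setICr.
have tail (g : R -> R) J : measurable_fun [set: R] g -> (forall z, 0 <= g z) ->
    (\int[lebesgue_measure]_z (g z)%:E = 1)%E ->
    (\int[lebesgue_measure]_(z in B) (g z)%:E = J%:E)%E ->
    (\int[lebesgue_measure]_(z in ~` B) (g z)%:E = (1 - J)%:E)%E.
  by move=> mg g0 + gJ; rewrite split// gJ EFinB => <-; rewrite addeAC subee// add0e.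
rewrite split => [|//|//]; last first.
  by apply: measurableT_comp => //; apply: measurable_funB.
apply: leeD2l; rewrite EFinD -(tail g1)// -(tail g2)//.
rewrite -ge0_integralD//=; last 4 first.
- by move=> z _; rewrite lee_fin.
- by apply/measurable_EFinP; apply: measurable_funS mg1.
- by move=> z _; rewrite lee_fin.
- by apply/measurable_EFinP; apply: measurable_funS mg2.
apply: ge0_le_integral => //=.
- apply/measurable_EFinP; apply: measurableT_comp => //.
  by apply: measurable_funB; [exact: measurable_funS mg1|exact: measurable_funS mg2].
- apply: emeasurable_funD; apply/measurable_EFinP.
    exact: measurable_funS mg1.
  exact: measurable_funS mg2.
- move=> z _; rewrite -EFinD lee_fin.
  by rewrite (le_trans (ler_normB _ _))// !ger0_norm.
Qed.

Lemma cvge_ge0_0 (R : realType) (u : nat -> \bar R) :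
  (forall n, 0 <= u n)%E ->
  (forall e : R, 0 < e -> \forall n \near \oo, (u n <= e%:E)%E) ->
  u n @[n --> \oo] --> 0%E.
Proof.
move=> u0 ue.
have fin e : 0 < e -> \forall n \near \oo, u n \is a fin_num /\ (u n <= e%:E)%E.
  move=> e0; apply: filterS (ue e e0) => n une; split=> //.
  by rewrite ge0_fin_numE// (le_lt_trans une)// ltry.
apply/fine_cvgP; split; first by apply: filterS (fin 1 ltr01) => n [].
apply/cvgrPdist_le => e /fin; apply: filterS => n [unfin une].
by rewrite sub0r normrN /= ger0_norm ?fine_ge0// -lee_fin fineK.
Qed.

Theorem theorem1 (R : realType) (alpha : nat -> R) (b : nat -> nat)
  (alpha_gt0 : forall i : nat, (1 <= i)%N -> 0 < alpha i)
  (alpha_nondecreasing :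
     forall i j : nat, (1 <= i)%N -> (i <= j)%N -> alpha i <= alpha j)
  (b_gt0 : forall n : nat, (1 <= n)%N -> (0 < b n)%N)
  (b_infty : b n @[n --> \oo] --> \oo) :
  L1_consistent (@phi_star R alpha b) (density_class alpha).
Proof.
move=> f cf x fx; have [df Vf] := cf; have [mf f0 f1] := df.
apply: cvge_ge0_0 => [n|eps eps0].
  by apply: integral_ge0 => y _; rewrite lee_fin.
(* The five shares: one for the cell frequencies, one for the oscillations, one for the tail of [f],
   and two for the tail of the histogram, which is within [e] of that of [f]. *)
pose e := eps / 5; have e0 : 0 < e by rewrite divr_gt0.
have finF (A : set R) : measurable A ->
    density_measure f A = (fine (density_measure f A))%:E.
  by move=> mA; rewrite fineK// fin_num_density_measure.
have [i i0 FB] : exists2 i, (0 < i)%N &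
    1 - e < fine (density_measure f [set` `[(- i%:R), i%:R[]).
  have /fine_cvgP[_ F1] := cvg_density_measure_itv df.
  have F1e : \forall i \near \oo,
      1 - e < fine (density_measure f [set` `[(- i%:R), i%:R[]).
    by apply: (cvgr_gt _ F1); rewrite gtrBl.
  have [i [i0 Fi]] := filter_ex (filterI (nbhs_infty_gt 0) F1e).
  by exists i.
have ai0 := alpha_gt0 i i0.
(* The first summand and [m <= 2^m] give [2^-m * 5 alpha(i) <= e], where 5 is 4 for the histogram
   plus 1 for [f]. The summand [i] ensures [i <= m], so that levels from [m] on are tested on the
   window [[-i, i[]. *)
pose m := ((Num.truncn (5 * alpha i / e)).+1 + i)%N.
have im : (i <= m)%N by exact: leq_addl.
have m0 : (0 < m)%N by rewrite addn_gt0 i0 orbT.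
have me : 2 ^- m * (5 * alpha i) <= e.
  rewrite mulrC ler_pdivrMr ?exprn_gt0// [leRHS]mulrC -ler_pdivrMr//.
  apply: (le_trans (ltW (truncnS_gt _))); rewrite -natrX ler_nat.
  by apply: leq_trans (ltnW (ltn_expl m (isT : 1 < 2)%N)); exact: leq_addr.
pose N := (i.*2 * 2 ^ m)%N; pose p := dyadic_grid R i m.
have pN : p N = i%:R by exact: dyadic_grid_end.
have p0 : p 0%N = - i%:R by exact: dyadic_grid0.
have pS q : p q < p q.+1 by exact: dyadic_grid_lt.
pose F (q r : nat) := fine (density_measure f [set` `[p q, p r[]).
pose E (n q r : nat) : R := empirical (first_terms x (n := n)) [set` `[p q, p r[].
have cvgE q r : E n q r @[n --> \oo] --> F q r by exact: cvg_empirical.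
have cells : \forall n \near \oo, \sum_(q < N) `|E n q q.+1 - F q q.+1| < e.
  have cvgS : \sum_(q < N) `|E n q q.+1 - F q q.+1| @[n --> \oo]
      --> \sum_(q < N) `|F q q.+1 - F q q.+1|.
    apply: cvg_big => [|q _]; first exact: add_continuous.
    by apply: cvg_norm; apply: cvgB; [exact: cvgE|exact: cvg_cst].
  apply: (cvgr_lt _ cvgS); rewrite big1// => q _.
  by rewrite subrr normr0.
have mass : \forall n \near \oo, F 0%N N - e < E n 0%N N.
  by apply: (cvgr_gt _ (cvgE 0%N N)); rewrite gtrBl.
have [wf [oscf wfC]] : exists w : nat -> R,
    (forall q y z, (q < N)%N -> p q <= y < p q.+1 -> p q <= z < p q.+1 ->
       `|f y - f z| <= w q) /\ \sum_(q < N) w q <= alpha i.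
  by apply: osc_cells => //; rewrite ?p0 ?pN ltW// Vf.
(* From here on [n] is fixed. It is positive, so that the histogram has total mass 1, and the
   selected level is at least [m], so that the histogram integrates to the empirical frequency on
   each grid cell. *)
apply: filterS3 cells mass (filterI (nbhs_infty_gt 0)
  (near_resolution b_infty m0 cf fx)) => n cells_n mass_n [n0 mres].
have res0 : resolution alpha b (first_terms x (n := n)) != 0%N.
  by rewrite -lt0n (leq_trans m0).
rewrite /phi_star (negbTE res0).
set k := resolution _ _ _ in mres *; set h := histogram _ k.
(* Since [i <= m <= k], the window is among those tested by admissibility at level [k]; the bound
   does not depend on [n]. *)
have Vh : (variation_co h (- i%:R) i%:R < (4 * alpha i)%:E)%E.
  by apply: resolution_admissible; rewrite // i0 (leq_trans im).
have [wh [osch whC]] : exists w : nat -> R,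
    (forall q y z, (q < N)%N -> p q <= y < p q.+1 -> p q <= z < p q.+1 ->
       `|h y - h z| <= w q) /\ \sum_(q < N) w q <= 4 * alpha i.
  by apply: osc_cells => //; rewrite ?p0 ?pN ltW// mulr_gt0.
have h1 : (\int[lebesgue_measure]_y (h y)%:E = 1)%E.
  rewrite integral_histogram// /empirical; congr (_%:E).
  under eq_bigr do rewrite indicT.
  by rewrite sumr_const card_ord divff// pnatr_eq0 -lt0n.
have inside := @integral_dist_grid R h f p N (2 ^- m) wh wf
  (fun q => E n q q.+1) (fun q => F q q.+1).
have tail := @integral_dist_tail R h f [set` `[p 0%N, p N[] (E n 0%N N) (F 0%N N).
have mh : measurable_fun [set: R] h by exact: measurable_histogram.
have hge0 y : 0 <= h y by exact: histogram_ge0.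
apply: le_trans (tail _ mh hge0 mf f0 h1 f1 _ _) _ => //.
- exact: integral_histogram_grid.
- exact: finF.
apply: le_trans (leeD2r _ (inside _ _ mh hge0 mf f0 _ _ osch oscf)) _.
- by rewrite invr_gt0 exprn_gt0.
- exact: dyadic_gridS.
- by move=> q _; exact: integral_histogram_grid.
- by move=> q _; exact: finF.
rewrite -EFinD lee_fin.
have osc_sum : 2 ^- m * (\sum_(q < N) wh q + \sum_(q < N) wf q) <= e.
  apply: le_trans me; apply: ler_wpM2l; first by rewrite invr_ge0 exprn_ge0.
  lra.
have FB' : 1 - e < F 0%N N by rewrite /F p0 pN.
have -> : eps = e + e + e + e + e by rewrite /e; field.
lra.
Qed.
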